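(* Let $(X,\mathcal{X},\mu)$ be a $\sigma$-finite measure space such that $L^2(X,\mu)$ is separable and let $(\mathcal{E},\mathcal{D}(\mathcal{E}))$ be a local Dirichlet form on $L^2(X,\mu)$ admitting a carré du champ $\Gamma$. Let $\mathcal{B}$ be the algebra of bounded measurable functions on $X$ whose $\mu$-classes belong to $\mathcal{D}(\mathcal{E})$, and let $\mathcal{C}$ be an $\mathcal{E}^{1/2}$-dense subalgebra of $\mathcal{B}$ such that $\Gamma(f)\in L^\infty(X,\mu)$ for all $f\in\mathcal{C}$. Then the sequence $$0\longrightarrow\Omega^0(\mathcal{C})\stackrel{d_0}{\longrightarrow}\Omega^1(\mathcal{C})\stackrel{d_1}{\longrightarrow}\cdots\stackrel{d_{p-1}}{\longrightarrow}\Omega^p(\mathcal{C})\stackrel{d_p}{\longrightarrow}\cdots$$ is a cochain complex, where the spaces $\Omega^p(\mathcal{C})$ and operators $d_p$ are as defined in the context.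
   Context: **Dirichlet forms.** $\mathcal{E}(f):=\mathcal{E}(f,f)$. The Dirichlet form is local if for all $f\in\mathcal{D}(\mathcal{E})$ and $F,G\in C_c^\infty(\mathbb{R})$ with disjoint supports, $\mathcal{E}(F(f)-F(0),G(f)-G(0))=0$. It admits a carré du champ $\Gamma$ if for any $f\in\mathcal{B}$ there is $\Gamma(f)\in L^1(X,\mu)$ with $\mathcal{E}(fh,f)-\frac12\mathcal{E}(f^2,h)=\int_Xh\,\Gamma(f)\,d\mu$ for all $h\in\mathcal{B}$; $\Gamma$ extends to a continuous nonnegative definite symmetric bilinear map $\mathcal{D}(\mathcal{E})\times\mathcal{D}(\mathcal{E})\to L^1(X,\mu)$ with $\Gamma(f)=\Gamma(f,f)$. **First order structure.** Fix $(\varphi_k)_{k\ge1}\subset\mathcal{C}$ whose span $\mathcal{A}$ is $\mathcal{E}^{1/2}$-dense in $\mathcal{B}$, and versions $\widetilde\Gamma(\varphi_i,\varphi_j)$ of $\Gamma(\varphi_i,\varphi_j)$ such that for all $N$ and all $x\in X$ the matrix $(\widetilde\Gamma(\varphi_i,\varphi_j)(x))_{i,j\le N}$ is symmetric nonnegative definite; extend $\widetilde\Gamma$ bilinearly to $\mathcal{A}$. For $x\in X$ let $T_x^\ast X$ be the Hilbert space completion of $\mathcal{A}/\ker\|\cdot\|_{T_x^\ast X}$, $\|u\|_{T_x^\ast X}=\widetilde\Gamma(u,u)(x)^{1/2}$, and $d_{0,x}f$ the class of $f\in\mathcal{A}$. A section $\omega=(\omega_x)_{x\in X}$ of $T^\ast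 X=(T^\ast_xX)_{x\in X}$ is measurable if all $x\mapsto\langle\omega_x,d_{0,x}f\rangle_{T_x^\ast X}$, $f\in\mathcal{A}$, are measurable. The map $f\mapsto(d_{0,x}f)_{x\in X}$ extends uniquely to a linear map $d_0:\mathcal{B}\to L^2(X,T^\ast X,\mu)$ with $\|d_0f\|^2_{L^2(X,T^\ast X,\mu)}=\mathcal{E}(f)$; it satisfies $\langle d_0f,d_0g\rangle_{T_x^\ast X}=\Gamma(f,g)(x)$ for $\mu$-a.e. $x$ and $d_0(fg)=f\,d_0g+g\,d_0f$. If $\mathbf 1\in\mathcal{C}$, then $d_0\mathbf 1=0$ by locality. **Forms.** $\Lambda^pT_x^\ast X$ carries the scalar product $\langle v_1\wedge\cdots\wedge v_p,w_1\wedge\cdots\wedge w_p\rangle=\det[(\langle v_i,w_j\rangle_{T_x^\ast X})_{i,j=1}^p]$, with completion $\hat\Lambda^pT_x^\ast X$; a section of $\hat\Lambda^pT^\ast X$ is measurable if its pairings with all $d_{0,x}f_1\wedge\cdots\wedge d_{0,x}f_p$, $f_i\in\mathcal{A}$, are measurable. For $p\ge1$, $\Omega^p(\mathcal{C})=\mathrm{span}\{g\,d_0f_1\wedge\cdots\wedge d_0f_p: f_1,\dots,f_p\in\mathcal{C},\ g\in\mathcal{C}\oplus\mathbb{R}\}$, a space of $\mu$-classes of sections contained in $L^2(X,\hat\Lambda^pT^\ast X,\mu)\cap L^\infty(X,\hat\Lambda^pT^\ast X,\mu)$. $\Omega^0(\mathcal{C}):=\mathcal{C}$ if $\mathcal{C}$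 contains the constants; otherwise $\Omega^0(\mathcal{C}):=\mathcal{C}\oplus\mathbb{R}$ and $d_0(f+c):=d_0f$ for $f\in\mathcal{C}$, $c\in\mathbb{R}$. For $p\ge1$, $d_p:\Omega^p(\mathcal{C})\to\Omega^{p+1}(\mathcal{C})$ denotes the linear map determined by $d_p(g\,d_0f_1\wedge\cdots\wedge d_0f_p)=d_0g\wedge d_0f_1\wedge\cdots\wedge d_0f_p$ for $f_i\in\mathcal{C}$, $g\in\mathcal{C}\oplus\mathbb{R}$; as in the paper, the linear maps $d_p$ are part of the setting. *)

(* Defs.v *)
From HB Require Import structures.
From mathcomp Require Import all_boot all_order all_algebra.
From mathcomp Require Import all_classical all_reals all_analysis.

Set Implicit Arguments.
Unset Strict Implicit.
Unset Printing Implicit Defensive.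

Import Order.TTheory GRing.Theory Num.Theory.
Import numFieldNormedType.Exports.

Local Open Scope classical_set_scope.
Local Open Scope ring_scope.

Section Linear.
Context {R : realType}.

Definition subspace (V : lmodType R) (A : set V) : Prop :=
  A 0 /\ forall (a : R) u v, A u -> A v -> A (a *: u + v).

Definition linear_on (V W : lmodType R) (A : set V) (f : V -> W) : Prop :=
  forall (a : R) u v, A u -> A v -> f (a *: u + v) = a *: f u + f v.

Definition lspan (V : lmodType R) (S : set V) : set V :=
  [set v | exists (n : nat) (a : 'I_n -> R) (s : 'I_n -> V),
    (forall i, S (s i)) /\ v = \sum_(i < n) a i *: s i].

(* [V p] is an ambient space, [W p] the actual p-th space of the sequence and
   only the restriction of [d p] to [W p] matters. *)
Record cochain_complex (V : nat -> lmodType R) (W : forall p, set (V p))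
    (d : forall p, V p -> V p.+1) : Prop := {
  cochain_subspace : forall p, subspace (W p) ;
  cochain_linear : forall p, linear_on (W p) (d p) ;
  cochain_stable : forall p w, W p w -> W p.+1 (d p w) ;
  cochain_dd : forall p w, W p w -> d p.+1 (d p w) = 0 }.

End Linear.

Section Hilbert.
Context {R : realType}.

Record hilbertType := Hilbert {
  hilbert_sort :> completeNormedModType R ;
  hdot : hilbert_sort -> hilbert_sort -> R ;
  hdotC : forall u v, hdot u v = hdot v u ;
  hdotP : forall (a : R) u v w, hdot (a *: u + v) w = a * hdot u w + hdot v w ;
  hdot_norm : forall u, hdot u u = `|u| ^+ 2 }.

(* [j] exhibits [H] as the Hilbert space completion of A / ker ||.||, where
   ||.|| is the seminorm of the semi-inner product [b] on [A]; [j] is the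
   canonical map, so [j u] is the class of [u]. *)
Record hilbert_completion (V : lmodType R) (A : set V) (b : V -> V -> R)
    (H : hilbertType) (j : V -> H) : Prop := {
  completion_linear : linear_on A j ;
  completion_dot : forall u v, A u -> A v -> hdot (j u) (j v) = b u v ;
  completion_dense : dense (j @` A) }.

(* [w] exhibits [L] as the completion of the p-th exterior power of [H]:
   the linear map from the algebraic exterior power to [L] induced by the
   alternating multilinear map [w] is isometric for the scalar product
   det (<v_i, u_j>), which is positive definite, and it has dense range. *)
Record exterior_completion (H : hilbertType) (p : nat) (L : hilbertType)
    (w : ('I_p -> H) -> L) : Prop := {
  wedge_multilinear : forall (v : 'I_p -> H) (i : 'I_p) (a : R) (x y : H),
    w [eta v with i |-> a *: x + y] =
    a *: w [eta v with i |-> x] + w [eta v with i |-> y] ;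
  wedge_alternating : forall (v : 'I_p -> H) (i k : 'I_p),
    i != k -> v i = v k -> w v = 0 ;
  wedge_dot : forall v u : 'I_p -> H,
    hdot (w v) (w u) = \det (\matrix_(i < p, k < p) hdot (v i) (u k)) ;
  wedge_dense : dense (lspan (range w)) }.

End Hilbert.
Arguments hilbertType : clear implicits.

Section AeClasses.
Context d (T : measurableType d) (R : realType).
Variables (mu : {measure set T -> \bar R}) (V : T -> lmodType R).

Definition section_of : Type := forall x, V x.

HB.instance Definition _ := gen_eqMixin section_of.
HB.instance Definition _ := gen_choiceMixin section_of.

Definition ae_eq_sec (s t : section_of) : bool :=
  `[< \forall x \ae mu, s x = t x >].

Let ae_eq_sec_refl : reflexive ae_eq_sec.
Proof. by move=> s; apply/asboolP; exact: aeW. Qed.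

Let ae_eq_sec_sym : symmetric ae_eq_sec.
Proof.
by move=> s t; apply/idP/idP => /asboolP h; apply/asboolP;
  apply: filterS h => x.
Qed.

Let ae_eq_sec_trans : transitive ae_eq_sec.
Proof.
move=> t s u /asboolP st /asboolP tu; apply/asboolP.
by apply: filterS2 st tu => x -> ->.
Qed.

Canonical ae_eq_sec_equiv :=
  EquivRel ae_eq_sec ae_eq_sec_refl ae_eq_sec_sym ae_eq_sec_trans.

Definition ae_section : Type := {eq_quot ae_eq_sec}%qT.
HB.instance Definition _ := Choice.on ae_section.
HB.instance Definition _ := EqQuotient.on ae_section.

Definition ae_class (s : section_of) : ae_section := \pi_(ae_section)%qT s.

Lemma ae_classP (s t : section_of) :
  ae_class s = ae_class t <-> \forall x \ae mu, s x = t x.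
Proof.
split=> [h|h]; last by apply/eqmodP/asboolP.
by move/eqmodP: h => /asboolP.
Qed.

Lemma ae_class_repr (s : section_of) :
  \forall x \ae mu, repr (ae_class s) x = s x.
Proof. by apply/ae_classP; rewrite /ae_class reprK. Qed.

Lemma repr_aeK (u : ae_section) : ae_class (repr u) = u.
Proof. exact: reprK. Qed.

Definition ae_add (u v : ae_section) : ae_section :=
  ae_class (fun x => repr u x + repr v x).
Definition ae_opp (u : ae_section) : ae_section :=
  ae_class (fun x => - repr u x).
Definition ae_scale (a : R) (u : ae_section) : ae_section :=
  ae_class (fun x => a *: repr u x).

Let addA : associative ae_add.
Proof.
move=> u v w; apply/ae_classP.
apply: filterS2 (ae_class_repr (fun x => repr v x + repr w x))
  (ae_class_repr (fun x => repr u x + repr v x)) => x e1 e2.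
by rewrite /ae_add e1 e2 addrA.
Qed.

Let addC : commutative ae_add.
Proof. by move=> u v; apply/ae_classP/aeW => x; rewrite addrC. Qed.

Let add0 : left_id (ae_class (fun=> 0)) ae_add.
Proof.
move=> u; rewrite -[RHS]repr_aeK; apply/ae_classP.
by apply: filterS (ae_class_repr (fun=> 0)) => x ->; rewrite add0r.
Qed.

Let addN : left_inverse (ae_class (fun=> 0)) ae_opp ae_add.
Proof.
move=> u; apply/ae_classP.
by apply: filterS (ae_class_repr (fun x => - repr u x)) => x e;
  rewrite /ae_opp e addNr.
Qed.

HB.instance Definition _ := GRing.isZmodule.Build ae_section addA addC add0 addN.

Let scaleA a b u : ae_scale a (ae_scale b u) = ae_scale (a * b) u.
Proof.
apply/ae_classP.
by apply: filterS (ae_class_repr (fun x => b *: repr u x)) => x e;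
  rewrite /ae_scale e scalerA.
Qed.

Let scale1 : left_id 1 ae_scale.
Proof.
by move=> u; rewrite -[RHS]repr_aeK; apply/ae_classP/aeW => x; rewrite scale1r.
Qed.

Let scaleDr : right_distributive ae_scale +%R.
Proof.
move=> a u v; apply/ae_classP.
apply: filterS3 (ae_class_repr (fun x => repr u x + repr v x))
  (ae_class_repr (fun x => a *: repr u x))
  (ae_class_repr (fun x => a *: repr v x)) => x e1 e2 e3.
by rewrite /GRing.add/= /ae_add /ae_scale e1 e2 e3 scalerDr.
Qed.

Let scaleDl u : {morph ae_scale^~ u : a b / a + b}.
Proof.
move=> a b; apply/ae_classP.
apply: filterS2 (ae_class_repr (fun x => a *: repr u x))
  (ae_class_repr (fun x => b *: repr u x)) => x e1 e2.
by rewrite /ae_scale e1 e2 scalerDl.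
Qed.

HB.instance Definition _ := GRing.Zmodule_isLmodule.Build R ae_section
  scaleA scale1 scaleDr scaleDl.

End AeClasses.

Section DirichletForms.
Context d (T : measurableType d) (R : realType).
Variable mu : {measure set T -> \bar R}.

(* Elements of L^2(X, mu) are represented by functions in [Lfun mu 2%:E]; the
   field [dirichlet_ae] below says that the domain and the form are defined on
   mu-classes. *)
Definition L2norm (f : T -> R) : R := fine ('N[mu]_2%:E[EFin \o f]).

Definition L2_separable : Prop := exists u : nat -> T -> R,
  (forall n, u n \in Lfun mu 2%:E) /\
  forall f : T -> R, f \in Lfun mu 2%:E -> forall e : R, 0 < e ->
    exists n, L2norm (f - u n) < e.

Variables (D : set (T -> R)) (E : (T -> R) -> (T -> R) -> R).

Definition E1norm (f : T -> R) : R := Num.sqrt (E f f + L2norm f ^+ 2).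

Record dirichlet_form : Prop := {
  dirichlet_L2 : forall f, D f -> f \in Lfun mu 2%:E ;
  dirichlet_ae : forall f g, D f -> measurable_fun setT g ->
    (\forall x \ae mu, f x = g x) -> D g /\ forall h, D h -> E g h = E f h ;
  dirichlet_subspace : subspace D ;
  dirichlet_dense : forall f : T -> R, f \in Lfun mu 2%:E ->
    forall e : R, 0 < e -> exists2 g, D g & L2norm (f - g) < e ;
  dirichlet_linear : forall h, D h -> linear_on D (E^~ h : _ -> R^o) ;
  dirichlet_sym : forall f g, D f -> D g -> E f g = E g f ;
  dirichlet_ge0 : forall f, D f -> 0 <= E f f ;
  dirichlet_closed : forall u : nat -> T -> R, (forall n, D (u n)) ->
    (forall e : R, 0 < e -> exists N, forall m n, (N <= m)%N -> (N <= n)%N ->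
      E1norm (u m - u n) < e) ->
    exists2 f, D f & E1norm (u n - f) @[n --> \oo] --> (0 : R) ;
  dirichlet_markov : forall f, D f ->
    let f1 x := Num.min (Num.max (f x) 0) 1 in D f1 /\ E f1 f1 <= E f f }.

Definition supp (F : R -> R) : set R := closure [set t | F t != 0].

Definition smooth_compact (F : R -> R) : Prop :=
  (forall n t, derivable (derive1n n F) t 1) /\ compact (supp F).

Definition local_form : Prop := forall (f : T -> R) (F G : R -> R), D f ->
  smooth_compact F -> smooth_compact G -> supp F `&` supp G = set0 ->
  E (fun x => F (f x) - F 0) (fun x => G (f x) - G 0) = 0.

Definition bounded_domain : set (T -> R) :=
  [set f : T -> R |
    [/\ measurable_fun setT f, exists M : R, forall x, `|f x| <= M & D f]].

Local Notation B := bounded_domain.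

(* [Gam f g] is a representative of the class Gamma(f, g) in L^1; [Gam] is the
   continuous extension to D of the operator characterized on B by [cdc_eq]. *)
Record carre_du_champ (Gam : (T -> R) -> (T -> R) -> T -> R) : Prop := {
  cdc_L1 : forall f g, D f -> D g -> Gam f g \in Lfun mu 1%E ;
  cdc_eq : forall f h, B f -> B h ->
    E (f \* h) f - 2^-1 * E (f \* f) h = \int[mu]_x (h x * Gam f f x) ;
  cdc_linear : forall (a : R) f g h, D f -> D g -> D h ->
    \forall x \ae mu, Gam (a *: f + g) h x = a * Gam f h x + Gam g h x ;
  cdc_sym : forall f g, D f -> D g -> \forall x \ae mu, Gam f g x = Gam g f x ;
  cdc_ge0 : forall f, D f -> \forall x \ae mu, 0 <= Gam f f x ;
  cdc_continuous : forall f g, D f -> D g -> forall e : R, 0 < e ->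
    exists2 r : R, 0 < r & forall f' g', D f' -> D g' ->
      E1norm (f' - f) < r -> E1norm (g' - g) < r ->
      ('N[mu]_1[EFin \o (Gam f' g' - Gam f g)%R] < e%:E)%E }.

Definition energy_dense (A S : set (T -> R)) : Prop :=
  A `<=` S /\ forall f, S f -> forall e : R, 0 < e ->
    exists2 g, A g & Num.sqrt (E (f - g) (f - g)) < e.

(* Not necessarily unital: constants need not be in L^2. *)
Definition subalgebra (C : set (T -> R)) : Prop :=
  subspace C /\ forall f g, C f -> C g -> C (f \* g).

(* [phi] is indexed from 0.  [Gt x] is the bilinear extension to span phi of
   the chosen versions of Gamma(phi_i, phi_j) at the point x. *)
Record gamma_version (Gam : (T -> R) -> (T -> R) -> T -> R)
    (phi : nat -> T -> R) (Gt : T -> (T -> R) -> (T -> R) -> R) : Prop := {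
  gamma_version_ae : forall i j,
    measurable_fun setT (fun x => Gt x (phi i) (phi j)) /\
    \forall x \ae mu, Gt x (phi i) (phi j) = Gam (phi i) (phi j) x ;
  gamma_version_psd : forall N x,
    let M := \matrix_(i < N, j < N) Gt x (phi i) (phi j) in
    M^T = M /\ forall v : 'rV_N, 0 <= (v *m M *m v^T) 0 0 ;
  gamma_version_linearl : forall x g, lspan (range phi) g ->
    linear_on (lspan (range phi)) (Gt x ^~ g : _ -> R^o) ;
  gamma_version_linearr : forall x f, lspan (range phi) f ->
    linear_on (lspan (range phi)) (Gt x f : _ -> R^o) }.

End DirichletForms.

Section Forms.
Context d (T : measurableType d) (R : realType).
Variable mu : {measure set T -> \bar R}.

Definition measurable_section (A : set (T -> R)) (H : T -> hilbertType R)
    (d0x : forall x, (T -> R) -> H x) (s : forall x, H x) : Prop :=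
  forall f, A f -> measurable_fun setT (fun x => hdot (s x) (d0x x f)).

(* [d0] is the linear extension of f |-> (d_{0,x} f)_x from A to B, with values
   in the space L^2(X, T^* X, mu) of classes of measurable sections. *)
Record exterior_derivation (E : (T -> R) -> (T -> R) -> R)
    (A B : set (T -> R)) (H : T -> hilbertType R)
    (d0x : forall x, (T -> R) -> H x)
    (d0 : (T -> R) -> ae_section mu H) : Prop := {
  d0_linear : linear_on B d0 ;
  d0_extends : forall f, A f -> d0 f = ae_class mu (d0x ^~ f) ;
  d0_isometry : forall f, B f -> exists s : forall x, H x,
    [/\ measurable_section A d0x s, d0 f = ae_class mu s &
        (\int[mu]_x (`|s x| ^+ 2)%:E = (E f f)%:E)%E] }.

Variables (H : T -> hilbertType R) (L : nat -> T -> hilbertType R).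
Variable w : forall p x, ('I_p -> H x) -> L p x.
Variables (C : set (T -> R)) (d0 : (T -> R) -> ae_section mu H).

(* g om_1 /\ ... /\ om_p; a.e. equal representatives give the same class. *)
Definition wedge_class (p : nat) (g : T -> R) (om : 'I_p -> ae_section mu H) :
    ae_section mu (L p) :=
  ae_class mu (fun x => g x *: w (fun i => repr (om i) x)).

Definition plus_constants : set (T -> R) :=
  [set h | exists f (c : R), C f /\ h = f + cst c].

(* The extension of d_0 to C + R.  If C contains the constants then C + R = C;
   otherwise the sum is direct and d_0 (f + c) = d_0 f, the [xget] returning the
   unique f. *)
Definition d0_ext (h : T -> R) : ae_section mu H :=
  if `[< C (cst 1) >] then d0 h
  else d0 (xget 0 [set f | C f /\ exists c : R, h = f + cst c]).

(* Forms of degree 0 are functions, forms of degree p >= 1 are mu-classes of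
   sections; T^*X is identified with its first exterior power. *)
Definition form_space (p : nat) : lmodType R :=
  if p is q.+1 then ae_section mu (L q.+1) else (T -> R^o).

Definition Omega (p : nat) : set (form_space p) :=
  match p return set (form_space p) with
  | 0 => if `[< C (cst 1) >] then C else plus_constants
  | q.+1 => lspan [set om | exists g (f : 'I_q.+1 -> T -> R),
      [/\ plus_constants g, (forall i, C (f i)) &
          om = wedge_class g (fun i => d0 (f i))]]
  end.

Record form_derivation (dd : forall p, form_space p -> form_space p.+1) :
    Prop := {
  fd_linear : forall p, linear_on (@Omega p) (dd p) ;
  fd_zero : forall g, @Omega 0 g ->
    dd 0 g = wedge_class (cst 1) (fun _ : 'I_1 => d0_ext g) ;
  fd_succ : forall p g (f : 'I_p.+1 -> T -> R),
    plus_constants g -> (forall i, C (f i)) ->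
    dd p.+1 (wedge_class g (fun i => d0 (f i))) =
    wedge_class (cst 1)
      (fun i : 'I_p.+2 => oapp (fun k => d0 (f k)) (d0_ext g) (unlift ord0 i)) }.

End Forms.

(* Main.v *)
Require Import Defs.
From HB Require Import structures.
From mathcomp Require Import all_boot all_order all_algebra.
From mathcomp Require Import all_classical all_reals all_analysis.
From mathcomp Require Import measurable_realfun ring lra.

Import Order.TTheory GRing.Theory Num.Theory.
Import numFieldNormedType.Exports.

Local Open Scope classical_set_scope.
Local Open Scope ring_scope.

(* On a generator, d (d (g d0 f_1 /\ ... /\ d0 f_p)) is a wedge product with the
   factor d0 1, so everything reduces to d0 1 = 0.  If C does not contain the
   constants this is the definition of the extension of d0 to C + R.  Otherwise
   1 lies in the domain; two bump functions F around 1 and G around 0 with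
   disjoint supports give F(1) - F(0) = F(1) and G(1) - G(0) = - G(0), so that
   locality reads - F(1) G(0) E(1, 1) = 0, and E(1, 1) is the square of the norm
   of d0 1. *)

(** * Smoothness of functions of the type exp (-1/q), q a polynomial *)

Section FlatFunctions.
Context {R : realType}.
Variable q : {poly R}.
Implicit Types (p : {poly R}) (k : nat) (t : R).

(* The family [p / q ^ k * expR (- 1 / q)], cut off where [q <= 0], is closed
   under differentiation. *)
Definition flat_fun p k t : R :=
  if 0 < q.[t] then p.[t] * (q.[t] ^+ k)^-1 * expR (- q.[t]^-1) else 0.

(** Numerator over the common denominator [q ^ (k + 2)]: the three summands come from
    differentiating [p], the power [q ^ -k] and the exponential. *)
Definition flat_deriv p k : {poly R} :=
  p^`() * q ^+ 2 - k%:R *: (p * q^`() * q) + p * q^`().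

(** At [1 / y] the exponential dominates the term of degree [k + 1] of its series; then take
    inverses. *)
Lemma expRNV_le (y : R) k : 0 < y -> expR (- y^-1) <= k.+1`!%:R * y ^+ k.+1.
Proof.
move=> y0; have fk : (0 : R) < k.+1`!%:R by rewrite ltr0n fact_gt0.
have yk : 0 < y ^+ k.+1 by rewrite exprn_gt0.
rewrite expRN -[leRHS]invrK lef_pV2 ?posrE ?expR_gt0 ?invr_gt0 ?mulr_gt0//.
apply: le_trans (@expR_ge1Dxn R y^-1 k _); last by rewrite invr_ge0 ltW.
by rewrite invfM mulrC exprVn lerDr.
Qed.

(** Exponential decay is invoked in degree [k + 2], so that [q ^ 2] survives the division by
    [q ^ k]; this kills the difference quotient at a zero of [q]. *)
Lemma flat_fun_le p k t :
  `|flat_fun p k t| <= k.+2`!%:R * `|p.[t]| * q.[t] ^+ 2.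
Proof.
rewrite /flat_fun; case: ifPn => [q0|_]; last first.
  by rewrite normr0 mulr_ge0 ?sqr_ge0// mulr_ge0.
have qk : 0 < q.[t] ^+ k by rewrite exprn_gt0.
have h : (q.[t] ^+ k)^-1 * expR (- q.[t]^-1) <= k.+2`!%:R * q.[t] ^+ 2.
  rewrite ler_pdivrMl// mulrCA -exprD addn2.
  exact: expRNV_le.
rewrite -mulrA normrM (ger0_norm (_ : 0 <= _^-1 * _)); last first.
  by rewrite mulr_ge0 ?expR_ge0// invr_ge0 ltW.
by rewrite mulrAC mulrC ler_wpM2r.
Qed.

Lemma is_derive_flat_fun p k t :
  is_derive t 1 (flat_fun p k) (flat_fun (flat_deriv p k) k.+2 t).
Proof.
have cq : q.[s] @[s --> t] --> q.[t] by exact: continuous_horner.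
have [q0|q0|q0] := ltgtP 0 q.[t].
- apply: (@near_eq_is_derive _ _ _
    (fun s => p.[s] * ((q.[s] ^+ k)^-1 * expR (- q.[s]^-1)))).
    near=> s; rewrite /flat_fun ifT ?mulrA//.
    by near: s; exact: cvgr_gt cq _ q0.
  have nq : q.[t] != 0 by rewrite gt_eqF.
  have nqk : q.[t] ^+ k != 0 by rewrite expf_neq0.
  have dq := is_derive_poly q t.
  have dqk : is_derive t 1 (fun s => q.[s] ^+ k)
      ((k%:R * q.[t] ^+ k.-1) *: q^`().[t]).
    rewrite (_ : (fun _ => _) = horner q ^+ k); first exact: is_deriveX.
    by rewrite exprfctE.
  have dqkV := @is_deriveV _ (fun s => q.[s] ^+ k) _ _ _ nqk dqk.
  have dV := is_deriveN (@is_deriveV _ (horner q) _ _ _ nq dq).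
  have de := is_derive1_comp (is_derive_expR _) dV.
  have D := is_deriveM (is_derive_poly p t) (is_deriveM dqkV de).
  apply: is_derive_eq D _.
  rewrite /flat_fun q0 /flat_deriv !hornerE /GRing.scale/=.
  (* The derivative of [q ^+ k] carries the exponent [k.-1], so [k = 0] is treated apart. *)
  case: (k) => [|j]; rewrite !fctE/= ?expr0 ?invr1 ?mulr1;
    rewrite /= ?exprS ?expr0; field; rewrite ?expf_neq0 ?nq//.
- rewrite [flat_fun (flat_deriv _ _) _ _]/flat_fun ltNge (ltW q0)/=.
  apply: (@near_eq_is_derive _ _ _ (cst 0)).
  near=> s; rewrite /flat_fun ltNge [_ <= _](ltW _)//.
  by near: s; exact: cvgr_lt cq _ q0.
- rewrite {2}/flat_fun -q0 ltxx.
  have /factor_theorem[r qE] : root q t by rewrite /root -q0.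
  apply/is_derive1_caratheodory.
  (* The slope takes the value [0] at [z = t] by the convention [x / 0 = 0], and this is the
     derivative claimed there. *)
  exists (fun z => flat_fun p k z / (z - t)); split.
  + move=> z; rewrite {2}/flat_fun -q0 ltxx subr0.
    have [->|zt] := eqVneq z t; last by rewrite divfK// subr_eq0.
    by rewrite {1}/flat_fun -q0 ltxx subrr mulr0.
  + rewrite /prop_for/continuous_at/= subrr invr0 mulr0; apply/norm_cvg0P.
    (* Since [q = r (X - t)], the quadratic bound divided by [|z - t|] keeps one factor [z - t]. *)
    pose u : {poly R} := k.+2`!%:R *: (p * ('X - t%:P) * r ^+ 2).
    apply: (@squeeze_cvgr _ _ _ _ (cst 0) (fun z => `|u.[z]|)).
    * near=> z; rewrite normr_ge0/=.
      have [->|zt] := eqVneq z t.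
        by rewrite subrr invr0 mulr0 normr0.
      rewrite normrM normfV ler_pdivrMr ?normr_gt0 ?subr_eq0//.
      rewrite (le_trans (flat_fun_le _ _ _))// -(real_normK (num_real q.[z])).
      rewrite qE /u !hornerE/= !normrM normr_nat.
      rewrite le_eqVlt; apply/orP; left; apply/eqP; ring.
    * exact: cvg_cst.
    * rewrite [X in _ --> X](_ : 0 = `|u.[t]|); last first.
        by rewrite /u !hornerE/= subrr !(mulr0, mul0r) normr0.
      have : u.[z] @[z --> t] --> u.[t] by exact: continuous_horner.
      exact: cvg_norm.
  + by rewrite subrr invr0 mulr0.
Unshelve. all: by end_near. Qed.

Lemma derive1n_flat_fun p k n : exists p' k',
  derive1n n (flat_fun p k) = flat_fun p' k'.
Proof.
elim: n => [|n [p' [k' IHn]]]; first by exists p, k.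
exists (flat_deriv p' k'), k'.+2; rewrite derive1nS IHn.
apply/funext => t; rewrite derive1E.
by case: (is_derive_flat_fun p' k' t).
Qed.

Lemma smooth_flat_fun p k n t : derivable (derive1n n (flat_fun p k)) t 1.
Proof.
have [p' [k' ->]] := derive1n_flat_fun p k n.
by case: (is_derive_flat_fun p' k' t).
Qed.

End FlatFunctions.

(** * Smooth bump functions with compact support *)

Section BumpFunctions.
Context {R : realType}.
Implicit Types c t : R.

(** This is [exp (-1 / (1/9 - (t - c)^2))] for [|t - c| < 1/3] and [0] elsewhere; a radius below
    [1/2] keeps the closed supports around [0] and [1] apart. *)
Definition bump_fun c : R -> R :=
  flat_fun ((3^-1 ^+ 2)%:P - ('X - c%:P) ^+ 2) 1 0.

Lemma bump_fun_eq0 c t : 3^-1 <= `|t - c| -> bump_fun c t = 0.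
Proof.
move=> h; rewrite /bump_fun /flat_fun !hornerE ifF//; apply/negbTE.
rewrite -leNgt subr_le0 -(real_normK (num_real (_ - _))).
by rewrite ler_pXn2r ?nnegrE ?invr_ge0.
Qed.

Lemma bump_fun_neq0 c : bump_fun c c != 0.
Proof.
by rewrite /bump_fun /flat_fun !hornerE subrr expr0n/= subr0 ifT ?invr_gt0.
Qed.

Lemma supp_bump_fun c : supp (bump_fun c) `<=` `[c - 3^-1, c + 3^-1].
Proof.
rewrite /supp closureE => s; apply; split=> [|t /= t0].
  exact: interval_closed.
rewrite in_itv/= -ler_distlC; apply: contra_neqT t0 => h.
by rewrite bump_fun_eq0// distrC ltW// ltNge.
Qed.

Lemma smooth_compact_bump_fun c : smooth_compact (bump_fun c).
Proof.
split=> [n t|]; first exact: smooth_flat_fun.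
apply: subclosed_compact (@segment_compact _ _ _) (@supp_bump_fun c).
exact: closed_closure.
Qed.

End BumpFunctions.

(** * Spans and maps linear on a subspace *)

Section LinearLemmas.
Context {R : realType}.
Implicit Types V W : lmodType R.

Lemma linear_on0 V W (A : set V) (f : V -> W) :
  A 0 -> linear_on A f -> f 0 = 0.
Proof.
move=> A0 /(_ (-1) 0 0 A0 A0); rewrite !scaleN1r oppr0 addr0 => ->.
by rewrite addNr.
Qed.

Lemma subspace_lspan V (S : set V) : Defs.subspace (lspan S).
Proof.
split=> [|a u v [m [b [s [Ss ->]]]] [n [c [t [St ->]]]]].
  by exists 0%N, (fun=> 0), (fun=> 0); split=> [[]//|]; rewrite big_ord0.
exists (m + n)%N,
  (fun i => match fintype.split i with inl j => a * b j | inr j => c j end),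
  (fun i => match fintype.split i with inl j => s j | inr j => t j end).
split=> [i|]; first by case: (fintype.split i).
rewrite big_split_ord/= scaler_sumr; congr (_ + _); apply: eq_bigr => i _.
  by rewrite (unsplitK (inl _ i)) scalerA.
by rewrite (unsplitK (inr _ i)).
Qed.

Lemma sub_lspan V (S : set V) : S `<=` lspan S.
Proof.
move=> v Sv; exists 1%N, (fun=> 1), (fun=> v); split=> //.
by rewrite big_ord1 scale1r.
Qed.

Lemma lspan_ind V (S P : set V) : Defs.subspace P -> S `<=` P -> lspan S `<=` P.
Proof.
move=> [P0 Plin] SP v [n [a [s [Ss ->]]]].
elim/big_rec: _ => // i u _ Pu; exact/Plin/Pu/SP.
Qed.

(** The preimage is taken inside [A], where [f] is linear; with [lspan_ind] it carries identities
    from generators to their span. *)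
Lemma subspace_preimage V W (A : set V) (B : set W) (f : V -> W) :
  Defs.subspace A -> Defs.subspace B -> linear_on A f ->
  Defs.subspace [set u | A u /\ B (f u)].
Proof.
move=> [A0 Al] [B0 Bl] lf; split=> [|a u v [Au Bu] [Av Bv]].
  by rewrite /= (linear_on0 _ _ _ _ A0 lf).
by split; [exact: Al|rewrite lf//; exact: Bl].
Qed.

End LinearLemmas.

(** * Cauchy-Schwarz and orthogonality to dense sets *)

Section HilbertLemmas.
Context {R : realType} {H : hilbertType R}.
Implicit Types u v : H.

Lemma hdot0l v : hdot 0 v = 0.
Proof.
by have := hdotP 1 0 0 v; rewrite scale1r addr0 mul1r => /eqP;
  rewrite -subr_eq0 opprD addNKr oppr_eq0 => /eqP.
Qed.

Lemma hdotDZ (a : R) u v :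
  hdot (a *: u + v) (a *: u + v) =
  a ^+ 2 * hdot u u + 2 * a * hdot u v + hdot v v.
Proof.
rewrite hdotP (hdotC u (_ + _)) (hdotC v (_ + _)) !hdotP (hdotC v u); ring.
Qed.

Lemma hdot_ge0 u : 0 <= hdot u u.
Proof. by rewrite hdot_norm sqr_ge0. Qed.

Lemma cauchy_schwarz u v : hdot u v ^+ 2 <= hdot u u * hdot v v.
Proof.
have [v0|v0] := eqVneq (hdot v v) 0.
  have {}v0 : v = 0 by apply/eqP; rewrite -normr_eq0 -sqrf_eq0 -hdot_norm v0.
  by rewrite v0 hdotC !hdot0l mulr0 expr0n.
have vp : 0 < hdot v v by rewrite lt_def v0 hdot_ge0.
(* The squared norm of [u] minus its projection onto [v]. *)
have := hdot_ge0 (- (hdot u v / hdot v v) *: v + u).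
rewrite hdotDZ (hdotC v u) => h.
have := mulr_ge0 (ltW vp) h.
rewrite [leRHS](_ : _ = hdot u u * hdot v v - hdot u v ^+ 2); last by field.
by rewrite subr_ge0.
Qed.

(* Pythagoras: a point of [A] closer to [v] than [`|v|] cannot be orthogonal to
   [v]. *)
Lemma dense_hdot_eq0 (A : set H) v : dense A ->
  (forall a, A a -> hdot v a = 0) -> v = 0.
Proof.
move=> dA vA; apply/eqP; rewrite -normr_eq0; apply/negPn/negP => v0.
have vp : 0 < `|v| by rewrite lt_def v0 normr_ge0.
have /(_ _)[||a [/= av Aa]] := dA (ball v `|v|).
- by exists v; exact: ballxx.
- exact: ball_open.
have := hdotDZ (-1) a v; rewrite (hdotC a) (vA _ Aa) !hdot_norm scaleN1r.
rewrite mulr0 addr0 sqrrN expr1n mul1r addrC => e.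
move: av; rewrite -ball_normE/= -(ltr_pXn2r (ltn0Sn 1)) ?nnegrE//.
by rewrite e ltNge lerDr sqr_ge0.
Qed.

End HilbertLemmas.

(** * Null integrals of possibly nonmeasurable functions *)

Section NonmeasurableMajorant.
Context d (T : measurableType d) (R : realType).
Variable mu : {measure set T -> \bar R}.

(* [f] need not be measurable: the integral of a nonnegative function is a
   supremum over the simple functions below it. *)
Lemma ge0_le_integral_eq0 (f g : T -> \bar R) : measurable_fun setT g ->
  (forall x, 0 <= g x)%E -> (forall x, g x <= f x)%E ->
  (\int[mu]_x f x = 0)%E -> \forall x \ae mu, g x = 0%E.
Proof.
move=> mg g0 gf f0.
have ig : (\int[mu]_x g x = 0)%E.
  apply/eqP; rewrite eq_le integral_ge0// andbT -f0.
  rewrite !ge0_integralTE// => [|x]; last exact: le_trans (gf x).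
  apply: le_ereal_sup => _ [h hg <-]; exists h => // x.
  exact: le_trans (hg x) (gf x).
have /ae_eq_integral_abs : (\int[mu]_x `|g x| = 0)%E.
  by rewrite -ig; apply: eq_integral => x _; rewrite gee0_abs.
move=> /(_ measurableT mg); apply: filterS => x; exact.
Qed.

End NonmeasurableMajorant.

(** * Sections with vanishing square integral *)

Section Sections.
Context {d} {T : measurableType d} {R : realType}.
Variables (mu : {measure set T -> \bar R}) (H : T -> hilbertType R).

(** Measurability of [s] is a condition on pairings, so the null integral is used through the
    pairings with the [phi k]. These are countably many, hence vanish together off one null set, and
    the span of the [phi k] has dense image in every fibre. *)
Lemma section_ae_eq0 (phi : nat -> T -> R) Gam
    (Gt : T -> (T -> R) -> (T -> R) -> R)
    (d0x : forall x, (T -> R) -> H x) (s : forall x, H x) :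
  gamma_version mu Gam phi Gt ->
  (forall x, hilbert_completion (lspan (range phi)) (Gt x) (d0x x)) ->
  measurable_section (lspan (range phi)) d0x s ->
  (\int[mu]_x (`|s x| ^+ 2)%:E = 0)%E -> \forall x \ae mu, s x = 0.
Proof.
move=> hGt hH ms s0.
have Aphi k : lspan (range phi) (phi k) by apply: sub_lspan; exists k.
have aek k : \forall x \ae mu, hdot (s x) (d0x x (phi k)) = 0.
  have G0 x : 0 <= Gt x (phi k) (phi k).
    by rewrite -(completion_dot (hH x))// hdot_ge0.
  (* Cauchy-Schwarz and [G <= expR G] bound [g x] by [`|s x| ^+ 2]. *)
  pose g x := hdot (s x) (d0x x (phi k)) ^+ 2 * expR (- Gt x (phi k) (phi k)).
  have g0 x : 0 <= g x by rewrite mulr_ge0 ?sqr_ge0 ?expR_ge0.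
  have mg : measurable_fun setT g.
    apply: measurable_funM; first exact/measurable_funX/ms.
    apply: measurableT_comp; first exact: measurable_expR.
    exact/measurable_funN/(gamma_version_ae hGt k k).1.
  have gs x : g x <= `|s x| ^+ 2.
    rewrite /g expRN ler_pdivrMr ?expR_gt0// (le_trans (cauchy_schwarz _ _))//.
    rewrite -hdot_norm ler_wpM2l ?hdot_ge0// (completion_dot (hH x))//.
    by rewrite (le_trans _ (expR_ge1Dx _))// lerDr.
  have : \forall x \ae mu, (EFin \o g) x = 0%E.
    apply: ge0_le_integral_eq0 s0 => //; exact/measurable_EFinP.
  apply: filterS => x /= [/eqP]; rewrite /g mulf_eq0.
  by rewrite [X in _ || X]gt_eqF ?expR_gt0// orbF sqrf_eq0 => /eqP.
have := ae_foralln aek; apply: filterS => x sx0.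
apply: dense_hdot_eq0 (completion_dense (hH x)) _ => _ [f Af <-].
suff : lspan (range phi) `<=`
    [set f | lspan (range phi) f /\ [set v | hdot (s x) v = 0] (d0x x f)].
  by move=> /(_ _ Af)[].
apply: lspan_ind => [|_ [k _ <-]]; last by split; [exact: Aphi|exact: sx0].
apply: subspace_preimage; first exact: subspace_lspan.
  split=> [|c u v /= su sv]; first by rewrite /= hdotC hdot0l.
  by rewrite hdotC hdotP !(hdotC _ (s x)) su sv mulr0 addr0.
exact: completion_linear (hH x).
Qed.

Lemma ae_class_eq0 (V : T -> lmodType R) (s : forall x, V x) :
  (\forall x \ae mu, s x = 0) -> ae_class mu s = 0.
Proof. by move=> s0; apply/ae_classP. Qed.

End Sections.

(** * Locality and the energy of the constant 1 *)

Section Locality.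
Context {d} {T : measurableType d} {R : realType}.
Variables (mu : {measure set T -> \bar R}).
Variables (D : set (T -> R)) (E : (T -> R) -> (T -> R) -> R).

Lemma local_form_cst1 : dirichlet_form mu D E -> local_form D E ->
  D (cst 1) -> E (cst 1) (cst 1) = 0.
Proof.
move=> hE hloc D1; have [D0 DL] := dirichlet_subspace hE.
have fE (F : R -> R) :
    (fun x : T => F (cst 1 x) - F 0) = (F 1 - F 0) *: (cst 1 : T -> R).
  by apply/funext => x; rewrite -[RHS]/((F 1 - F 0) * 1) mulr1.
have b10 : bump_fun 1 0 = 0 :> R.
  by apply: bump_fun_eq0; rewrite sub0r normrN normr1 invf_le1// ler1n.
have b01 : bump_fun 0 1 = 0 :> R.
  by apply: bump_fun_eq0; rewrite subr0 normr1 invf_le1// ler1n.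
have EZl u v c : D u -> D v -> E (c *: u) v = c * E u v.
  move=> Du Dv.
  have lE : linear_on D (E^~ v : _ -> R^o) by exact: dirichlet_linear hE _ Dv.
  by have := lE c u 0 Du D0; rewrite addr0 (linear_on0 _ _ _ _ D0 lE) addr0.
have DZ u c : D u -> D (c *: u) by move=> Du; rewrite -[_ *: _]addr0; apply: DL.
(* The supports lie in [[2/3, 4/3]] and [[-1/3, 1/3]]. *)
have disj : supp (bump_fun 1 : R -> R) `&` supp (bump_fun 0) = set0.
  apply/seteqP; split=> // t.
  move=> [/(@supp_bump_fun _ _ _) + /(@supp_bump_fun _ _ _)].
  rewrite /= !in_itv/=; lra.
have := hloc (cst 1) (bump_fun 1) (bump_fun 0) D1
  (smooth_compact_bump_fun 1) (smooth_compact_bump_fun 0) disj.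
rewrite !fE EZl//; last exact: DZ.
(* Linearity is available in the first argument; symmetry moves the second scalar there. *)
rewrite (dirichlet_sym hE)//; last exact: DZ.
rewrite EZl// b10 b01 subr0 sub0r => /eqP.
by rewrite !mulf_eq0 oppr_eq0 !(negbTE (bump_fun_neq0 _)) => /eqP.
Qed.

End Locality.

(** * The complex of forms, given that d0 1 = 0 when 1 lies in C *)

Section Complex.
Context {d} {T : measurableType d} {R : realType}.
Variable mu : {measure set T -> \bar R}.
Variables (H : T -> hilbertType R) (L : nat -> T -> hilbertType R).
Variable w : forall p x, ('I_p -> H x) -> L p x.
Variables (C : set (T -> R)) (d0 : (T -> R) -> ae_section mu H).
Hypothesis hw : forall p x, exterior_completion (w p x).
Hypothesis hC : Defs.subspace C.
Hypothesis d0l : linear_on C d0.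

(** Almost everywhere the representative of the zero factor vanishes and gives the Gram matrix a
    zero row; its determinant is the squared norm of the wedge. *)
Lemma wedge_class_eq0 p g (om : 'I_p -> ae_section mu H) i :
  om i = 0 -> wedge_class w g om = 0.
Proof.
move=> om0; apply: ae_class_eq0.
have := ae_class_repr mu (fun x : T => 0 : H x).
rewrite -[ae_class mu _]/(0 : ae_section mu H) -om0; apply: filterS => x r0.
set v := fun _ => _; suff -> : w p x v = 0 by rewrite scaler0.
apply/eqP; rewrite -normr_eq0 -sqrf_eq0 -hdot_norm (wedge_dot (hw p x)).
rewrite (expand_det_row _ i) big1// => j _.
by rewrite mxE /v r0 hdot0l mul0r.
Qed.

Lemma plus_constants1 : plus_constants C (cst 1).
Proof. by exists 0, 1; split; [case: hC|rewrite add0r]. Qed.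

(** Makes the differential of a generator a wedge with coefficient [1] of differentials from [C].
    Both outcomes of [xget], a chosen element and the default [0], lie in [C]. *)
Lemma d0_ext_in h : plus_constants C h -> exists2 f, C f & d0_ext C d0 h = d0 f.
Proof.
move=> [f [c [Cf ->]]]; rewrite /d0_ext; case: asboolP => C1.
  exists (f + cst c) => //; rewrite addrC (_ : cst c = c *: cst 1).
    exact: hC.2.
  by apply/funext => x; rewrite -[RHS]/(c * 1) mulr1.
case: xgetP => [g _ [Cg _]|_]; first by exists g.
by exists 0 => //; case: hC.
Qed.

(** If [C] lacks [1], the [C]-part of [1] must be [0]: it is a constant, and a nonzero one could be
    rescaled to [1] inside [C]. *)
Lemma d0_ext1 : (C (cst 1) -> d0 (cst 1) = 0) -> d0_ext C d0 (cst 1) = 0.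
Proof.
move=> d01; have [C0 CL] := hC; rewrite /d0_ext; case: asboolP => [/d01//|C1].
suff -> : xget 0 [set f | C f /\ exists c : R, cst 1 = f + cst c] = 0.
  exact: linear_on0 C0 d0l.
apply: xget_unique => /=; first by split=> //; exists 1; rewrite add0r.
move=> f [Cf [c fE]]; have {}fE : f = cst (1 - c).
  apply/funext => x; have /(congr1 (@^~ x)) := fE.
  by rewrite !fctE => ->; rewrite addrK.
have [c1|c1] := eqVneq (1 - c) 0; first by rewrite fE c1.
exfalso; apply: C1; have := CL (1 - c)^-1 f 0 Cf C0; rewrite addr0 fE.
by congr C; apply/funext => x; rewrite -[LHS]/((1 - c)^-1 * (1 - c)) mulVf.
Qed.

Local Notation Om p := (@Omega _ _ _ mu H L w C d0 p).

Lemma subspace_Omega p : Defs.subspace (Om p).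
Proof.
case: p => [|p]/=; last exact: subspace_lspan.
have [C0 CL] := hC; case: asboolP => // C1; split.
  by exists 0, 0; split=> //; rewrite add0r.
move=> a _ _ [f [c [Cf ->]]] [g [e [Cg ->]]].
exists (a *: f + g), (a * c + e); split; first exact: CL.
by apply/funext => x; rewrite -[LHS]/(a * (f x + c) + (g x + e)) mulrDr addrACA.
Qed.

Lemma Omega0_plus_constants g : Om 0 g -> plus_constants C g.
Proof.
rewrite /=; case: asboolP => // C1 Cg; exists g, 0; split=> //.
by apply/funext => x; rewrite fctE addr0.
Qed.

Lemma Omega_wedge p g (f : 'I_p.+1 -> T -> R) :
  plus_constants C g -> (forall i, C (f i)) ->
  Om p.+1 (wedge_class w g (fun i => d0 (f i))).
Proof. by move=> Cg Cf; apply: sub_lspan; exists g, f. Qed.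

Variable dd : forall p, form_space mu L p -> form_space mu L p.+1.
Hypothesis hdd : form_derivation w C d0 dd.
Hypothesis d01 : C (cst 1) -> d0 (cst 1) = 0.

Lemma dd_wedge1 p (f : 'I_p.+1 -> T -> R) : (forall i, C (f i)) ->
  dd p.+1 (wedge_class w (cst 1) (fun i => d0 (f i))) = 0.
Proof.
move=> Cf; rewrite (fd_succ hdd) //; last exact: plus_constants1.
(* Slot [ord0] holds the differential of the coefficient [1]. *)
by apply: (@wedge_class_eq0 _ _ _ ord0); rewrite unlift_none /= d0_ext1.
Qed.

Lemma dd_generator p om : (exists2 f : 'I_p.+1 -> T -> R, (forall i, C (f i)) &
    om = wedge_class w (cst 1) (fun i => d0 (f i))) ->
  Om p.+1 om /\ dd p.+1 om = 0.
Proof.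
move=> [f Cf ->]; split; last exact: dd_wedge1.
by apply: Omega_wedge => //; exact: plus_constants1.
Qed.

(** The two claims go together: each [dd] is linear only on its own form space, so extending the
    vanishing of the composite from generators to the span uses stability. *)
Lemma dd_Omega p om : Om p om ->
  Om p.+1 (dd p om) /\ dd p.+1 (dd p om) = 0.
Proof.
case: p om => [g Og|p om].
  apply: dd_generator; have /d0_ext_in[f Cf fE] := Omega0_plus_constants _ Og.
  by exists (fun=> f) => //; rewrite (fd_zero hdd)// fE.
suff sub : Om p.+1 `<=` [set u | Om p.+1 u /\
    [set v | Om p.+2 v /\ [set 0] (dd p.+2 v)] (dd p.+1 u)].
  by move=> /sub[].
apply: lspan_ind.
  apply: (subspace_preimage _ _ (Om p.+1)
    [set v | Om p.+2 v /\ [set 0] (dd p.+2 v)] (dd p.+1));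
    last exact: fd_linear.
    exact: subspace_Omega.
  apply: (subspace_preimage _ _ _ [set 0] (dd p.+2)); last exact: fd_linear.
    exact: subspace_Omega.
  by split=> // a u v -> ->; rewrite /= scaler0 addr0.
move=> _ [g [f [Cg Cf ->]]]; split; first exact: Omega_wedge.
apply: dd_generator; have [h Ch hE] := d0_ext_in _ Cg.
(* [h] enters at slot [ord0] and the [f i] shift up by one. *)
exists (fun i => oapp f h (unlift ord0 i)) => [i|].
  by case: (unlift _ _).
rewrite (fd_succ hdd)// hE; congr wedge_class; apply/funext => i.
by case: (unlift _ _).
Qed.

Lemma cochain_complex_Omega : cochain_complex (Omega w C d0) dd.
Proof.
split=> [p|p|p om /dd_Omega[]//|p om /dd_Omega[]//].
  exact: subspace_Omega.
exact: fd_linear hdd p.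
Qed.

End Complex.

Theorem theorem4p2 (d : measure_display) (X : measurableType d) (R : realType)
  (mu : {sigma_finite_measure set X -> \bar R})
  (hsep : L2_separable mu)
  (D : set (X -> R)) (E : (X -> R) -> (X -> R) -> R)
  (hE : dirichlet_form mu D E) (hloc : local_form D E)
  (Gam : (X -> R) -> (X -> R) -> X -> R) (hGam : carre_du_champ mu D E Gam)
  (C : set (X -> R))
  (hCdense : energy_dense E C (bounded_domain D))
  (hCalg : subalgebra C)
  (hCGam : forall f, C f -> Gam f f \in Lfun mu +oo%E)
  (phi : nat -> X -> R) (hphi : forall k, C (phi k))
  (hphidense : energy_dense E (lspan (range phi)) (bounded_domain D))
  (Gt : X -> (X -> R) -> (X -> R) -> R) (hGt : gamma_version mu Gam phi Gt)
  (H : X -> hilbertType R) (d0x : forall x, (X -> R) -> H x)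
  (hH : forall x, hilbert_completion (lspan (range phi)) (Gt x) (d0x x))
  (d0 : (X -> R) -> ae_section mu H)
  (hd0 : exterior_derivation E (lspan (range phi)) (bounded_domain D) d0x d0)
  (L : nat -> X -> hilbertType R)
  (w : forall p x, ('I_p -> H x) -> L p x)
  (hw : forall p x, exterior_completion (w p x))
  (dd : forall p, form_space mu L p -> form_space mu L p.+1)
  (hdd : form_derivation w C d0 dd) :
  cochain_complex (Omega w C d0) dd.
Proof.
have CB := hCdense.1; apply: cochain_complex_Omega => //.
- exact: hCalg.1.
- by move=> a u v /CB Bu /CB; exact: d0_linear hd0 _ _ _ Bu.
(* The isometry supplies a measurable representative [s] of [d0 (cst 1)] whose squared norm
   integrates to [E (cst 1) (cst 1)]. *)
move=> /CB B1; have [s [ms -> s1]] := d0_isometry hd0 B1.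
apply/ae_class_eq0/(section_ae_eq0 _ _ _ _ _ _ _ hGt hH ms); rewrite s1.
by case: B1 => _ _ D1; rewrite (local_form_cst1 _ _ _ hE hloc D1).
Qed.
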